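(* Let $A\colon\mathcal{X}\to 2^{\mathcal{X}^*}$ be maximally monotone, let $x\in\mathcal{X}$, let $u^*\in\mathcal{X}^*$, and let $\gamma\in\,]0,+\infty[$. Then the following hold: (i) $R_{\gamma(A-u^* )}x\neq\varnothing$. (ii) Let $z\in R_{\gamma(A-u^* )}x$. Then $$H_A(x,u^* )\geq\frac{\|x-z\|^2}{\gamma}\geq\frac{1}{2}d^2_{\operatorname{gra}A,\gamma}(x,u^* ).$$ (iii) Suppose that $\mathcal{X}$ is strictly convex. Then $R_{\gamma(A-u^* )}$ is single-valued and $$H_A(x,u^* )\geq\frac{\|x-R_{\gamma(A-u^* )}x\|^2}{\gamma}\geq\frac{1}{2}d^2_{\operatorname{gra}A,\gamma}(x,u^* ).$$
   Context: $\mathcal{X}\neq\{0\}$ is a reflexive real Banach space with topological dual $\mathcal{X}^*$, and $\langle\cdot,\cdot\rangle$ is the canonical duality pairing. For a set-valued operator $A\colon\mathcal{X}\to 2^{\mathcal{X}^*}$, $\operatorname{gra}A=\{(x,x^* )\in\mathcal{X}\times\mathcal{X}^*\mid x^*\in Ax\}$. $A$ is maximally monotone if, for every $(x,x^* )\in\mathcal{X}\times\mathcal{X}^*$, $(x,x^* )\in\operatorname{gra}A$ if and only if $\langle x-y,x^*-y^*\rangle\geq0$ for every $(y,y^* )\in\operatorname{gra}A$. The Haraux function of $A$ is $H_A\colon\mathcal{X}\times\mathcal{X}^*\to[-\infty,+\infty]\colon(x,u^* )\mapsto\sup_{(y,y^* )\in\operatorname{gra}A}\langle x-y,y^*-u^*\rangle$.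 The duality mapping of $\mathcal{X}$ is $\Delta\colon\mathcal{X}\to2^{\mathcal{X}^*}\colon x\mapsto\{x^*\in\mathcal{X}^*\mid\|x\|^2=\langle x,x^*\rangle=\|x^*\|^2\}$. The metric resolvent of an operator $A\colon\mathcal{X}\to 2^{\mathcal{X}^*}$ is $R_A\colon\mathcal{X}\to2^{\mathcal{X}}\colon x\mapsto\{z\in\mathcal{X}\mid 0\in Az+\Delta(z-x)\}$. When $R_A$ is single-valued, $R_Ax$ also denotes its unique value at $x$. For $u^*\in\mathcal{X}^*$ and $\gamma>0$, $\gamma(A-u^* )$ is the operator $x\mapsto\{\gamma(x^*-u^* )\mid x^*\in Ax\}$. For $\gamma\in\,]0,+\infty[$, set $|||(x,x^* )|||_\gamma=\sqrt{\|x\|^2/\gamma+\gamma\|x^*\|^2}$ for $(x,x^* )\in\mathcal{X}\times\mathcal{X}^*$, and for $\boldsymbol{C}\subset\mathcal{X}\times\mathcal{X}^*$ set $d_{\boldsymbol{C},\gamma}(x,x^* )=\inf_{(y,y^* )\in\boldsymbol{C}}|||(x,x^* )-(y,y^* )|||_\gamma\in[0,+\infty]$. *)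

(* Defs.v *)
From HB Require Import structures.
From mathcomp Require Import all_boot all_order all_algebra.
From mathcomp Require Import all_classical all_reals all_analysis.

Set Implicit Arguments.
Unset Strict Implicit.
Unset Printing Implicit Defensive.

Import Order.TTheory GRing.Theory Num.Theory.
Import numFieldNormedType.Exports.

Local Open Scope classical_set_scope.
Local Open Scope ring_scope.

(* The topological dual, as a subtype of the functions X -> R, with the
   operator norm. *)
Section DualSpace.
Context (R : realType) (X : normedModType R).

Definition dual_pred : {pred X -> R^o} :=
  fun f => `[< linear f /\ continuous f >].

Record dual := Dual { dual_fun : X -> R^o ; dual_funP : dual_fun \in dual_pred }.

HB.instance Definition _ := [isSub for dual_fun].
HB.instance Definition _ := [Choice of dual by <:].

Lemma dual_pred_submod_closed : submod_closed dual_pred.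
Proof.
split=> [|a f g].
  rewrite inE; split=> [a x y|]; last exact: cst_continuous.
  by rewrite -[LHS]/(0 : R^o) -[RHS]/(a *: 0 + 0 : R^o) scaler0 addr0.
rewrite !inE => -[lf cf] [lg cg].
split=> [b x y|x].
  rewrite -[LHS]/(a *: f _ + g _) lf lg.
  rewrite -[RHS]/(b *: (a *: f x + g x) + (a *: f y + g y)).
  by rewrite !scalerDr !scalerA [a * b]mulrC addrACA.
by apply: cvgD; [apply: cvgZr; exact: cf|exact: cg].
Qed.

HB.instance Definition _ :=
  GRing.isSubmodClosed.Build R (X -> R^o) dual_pred dual_pred_submod_closed.
HB.instance Definition _ := [SubChoice_isSubLmodule of dual by <:].

(* The duality pairing <x, f>. *)
Definition pairing (x : X) (f : dual) : R := dual_fun f x.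

Definition dual_norm (f : dual) : R :=
  sup [set `|pairing x f| | x in [set x : X | `|x| <= 1]].

Lemma dualE (f g : dual) : (forall x, pairing x f = pairing x g) -> f = g.
Proof. by move=> fg; apply/val_inj/funext. Qed.

Lemma pairingDr x f g : pairing x (f + g) = pairing x f + pairing x g.
Proof. by []. Qed.

Lemma pairingZr a x f : pairing x (a *: f) = a * pairing x f.
Proof. by []. Qed.

Lemma pairing0r x : pairing x 0 = 0.
Proof. by []. Qed.

Lemma pairing_linearl f : linear (pairing^~ f : X -> R^o).
Proof. by have := dual_funP f; rewrite inE => -[]. Qed.

Lemma pairing_continuousl f : continuous (pairing^~ f : X -> R^o).
Proof. by have := dual_funP f; rewrite inE => -[]. Qed.

Lemma pairingZl a x f : pairing (a *: x) f = a * pairing x f.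
Proof.
have lf := pairing_linearl f.
have f0 : pairing 0 f = 0.
  have := lf (- 1) 0 0; rewrite scaleN1r oppr0 addr0 => ->.
  by rewrite scaleN1r addNr.
by have := lf a x 0; rewrite addr0 f0 addr0.
Qed.

Lemma pairingDl x y f : pairing (x + y) f = pairing x f + pairing y f.
Proof. by have := pairing_linearl f 1 x y; rewrite !scale1r. Qed.

Lemma pairing_bounded f :
  has_ubound [set `|pairing x f| | x in [set x : X | `|x| <= 1]].
Proof.
pose g : {linear X -> R^o} :=
  HB.pack (pairing^~ f : X -> R^o)
    (GRing.isLinear.Build _ _ _ _ _ (pairing_linearl f)).
have /bounded_funP/(_ 1)[M gM] : bounded_near g (nbhs (0 : X)).
  exact/linear_bounded_continuous/pairing_continuousl.
by exists M => _ [x x1 <-]; exact: gM.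
Qed.

Lemma pairing_has_sup f :
  has_sup [set `|pairing x f| | x in [set x : X | `|x| <= 1]].
Proof.
split; last exact: pairing_bounded.
by exists `|pairing 0 f|, 0 => //=; rewrite normr0.
Qed.

Lemma le_dual_norm1 x f : `|x| <= 1 -> `|pairing x f| <= dual_norm f.
Proof. by move=> x1; apply: (ub_le_sup (pairing_bounded f)); exists x. Qed.

Lemma dual_norm_le f M :
  (forall x, `|x| <= 1 -> `|pairing x f| <= M) -> dual_norm f <= M.
Proof.
move=> fM; apply: ge_sup => [|_ [x x1 <-]]; last exact: fM.
by have [] := pairing_has_sup f.
Qed.

Lemma dual_norm_ge0 f : 0 <= dual_norm f.
Proof.
apply: (le_trans (normr_ge0 (pairing 0 f))).
by apply: le_dual_norm1; rewrite normr0.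
Qed.

Lemma le_dual_norm x f : `|pairing x f| <= dual_norm f * `|x|.
Proof.
have [->|x0] := eqVneq x 0.
  by rewrite -[X in pairing X _](scale0r (0 : X)) pairingZl mul0r !normr0 mulr0.
have nx0 : 0 < `|x| by rewrite normr_gt0.
rewrite -ler_pdivrMr// mulrC -[X in X * _](@ger0_norm _ `|x|^-1) ?invr_ge0//.
rewrite -normrM -pairingZl le_dual_norm1// normrZ ger0_norm ?invr_ge0//.
by rewrite mulVf// gt_eqF.
Qed.

Lemma dual_normD f g : dual_norm (f + g) <= dual_norm f + dual_norm g.
Proof.
apply: dual_norm_le => x x1; rewrite pairingDr (le_trans (ler_normD _ _))//.
by rewrite lerD// le_dual_norm1.
Qed.

Lemma dual_normZ a f : dual_norm (a *: f) = `|a| * dual_norm f.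
Proof.
have leZ b g : dual_norm (b *: g) <= `|b| * dual_norm g.
  apply: dual_norm_le => x x1.
  by rewrite pairingZr normrM ler_wpM2l// le_dual_norm1.
apply/eqP; rewrite eq_le leZ/=.
have [->|a0] := eqVneq a 0; first by rewrite normr0 mul0r dual_norm_ge0.
rewrite -ler_pdivlMl ?normr_gt0// -normfV.
by have := leZ a^-1 (a *: f); rewrite scalerA mulVf// scale1r.
Qed.

Lemma dual_norm0_eq0 f : dual_norm f = 0 -> f = 0.
Proof.
move=> f0; apply: dualE => x; apply/eqP; rewrite pairing0r -normr_eq0 eq_le.
by rewrite normr_ge0 andbT (le_trans (le_dual_norm x f))// f0 mul0r.
Qed.

HB.instance Definition _ :=
  Lmodule_isNormed.Build R dual dual_normD dual_normZ dual_norm0_eq0.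

Lemma dual_normE (f : dual) : `|f| = dual_norm f.
Proof. by []. Qed.

End DualSpace.

Section Bidual.
Context (R : realType) (X : normedModType R).

Lemma pairing_in_dual (x : X) :
  (pairing x : dual X -> R^o) \in @dual_pred R (dual X).
Proof.
rewrite inE; have lx : linear (pairing x : dual X -> R^o) by [].
split=> //.
pose g : {linear dual X -> R^o} :=
  HB.pack (pairing x : dual X -> R^o) (GRing.isLinear.Build _ _ _ _ _ lx).
apply: (@bounded_linear_continuous _ _ _ g); apply/bounded_funP => r.
exists (r * `|x|) => f fr; apply: (le_trans (le_dual_norm x f)).
by rewrite ler_wpM2r// -dual_normE.
Qed.

Definition bidual_embed (x : X) : dual (dual X) := Dual (pairing_in_dual x).

Definition reflexive_space : Prop := range bidual_embed = setT.

Definition strictly_convex : Prop := forall x y : X,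
  `|x| = 1 -> `|y| = 1 -> x != y -> `|2^-1 *: (x + y)| < 1.

End Bidual.

(* Set-valued operators from S to the subsets of T are functions S -> set T. *)
Section SetValued.
Context (S T : Type).

Definition gra (A : S -> set T) : set (S * T) := [set p | A p.1 p.2].

Definition single_valued (A : S -> set T) : Prop :=
  forall x, exists y, A x = [set y].

End SetValued.

Section MonotoneOperators.
Context (R : realType) (X : normedModType R).
Implicit Types (A : X -> set (dual X)) (x : X) (u : dual X) (gamma : R).

Definition maximally_monotone A : Prop := forall p : X * dual X,
  gra A p <->
  (forall q, gra A q -> 0 <= pairing (p.1 - q.1) (p.2 - q.2)).

Definition Haraux A x u : \bar R :=
  ereal_sup [set (pairing (x - q.1) (q.2 - u))%:E | q in gra A].

Definition duality_map x : set (dual X) :=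
  [set f | `|x| ^+ 2 = pairing x f /\ pairing x f = `|f| ^+ 2].

Definition metric_resolvent A x : set X :=
  [set z | [set f + g | f in A z & g in duality_map (z - x)] 0].

(* gamma (A - u) *)
Definition scale_shift gamma A u : X -> set (dual X) :=
  fun x => [set gamma *: (f - u) | f in A x].

(* The unique element of T x when T is single-valued (0 is a dummy default). *)
Definition value_at (T : X -> set X) x : X := xget 0 (T x).

Definition norm_gamma gamma (p : X * dual X) : R :=
  Num.sqrt (`|p.1| ^+ 2 / gamma + gamma * `|p.2| ^+ 2).

Definition dist_gamma gamma (C : set (X * dual X)) (p : X * dual X) : \bar R :=
  ereal_inf [set (norm_gamma gamma (p - q))%:E | q in C].

End MonotoneOperators.

(* Main.v *)
From HB Require Import structures.
Require Import Defs.
From mathcomp Require Import all_boot all_order all_algebra.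
From mathcomp Require Import all_classical all_reals all_analysis.
From mathcomp Require Import ring lra.

Import Order.TTheory GRing.Theory Num.Theory.
Import numFieldNormedType.Exports.

Local Open Scope classical_set_scope.
Local Open Scope ring_scope.

(** The idea: everything except the nonemptiness of the resolvent is a direct
    computation, and nonemptiness is Rockafellar's surjectivity theorem, proved
    here by convex duality on X * X^*.

    A point z lies in the resolvent at x exactly when some f in A z satisfies
    gamma (u - f) in Delta (z - x) (metric_resolvent_scale_shiftP). Then
    |x - z|^2 / gamma = <x - z, f - u> is one of the terms of the supremum that
    defines H_A (x, u), and |x - z| = gamma |u - f|, so that the point (z, f) of
    the graph is at squared distance 2 |x - z|^2 / gamma from (x, u). If the
    space is strictly convex and z, z' are two such points, monotonicity gives
    <a - b, j - j'> <= 0 for a = z - x, b = z' - x and j, j' in their duality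
    images; this forces |a| = |b| and |a + b| >= 2 |a|, hence a = b.

    For existence, the operator y |-> gamma (A (y + x) - u) is again maximally
    monotone, so it suffices to find, for any maximally monotone B, a point
    (z, f) of its graph with - f in Delta z (maximally_monotone_duality_map).
    The Fitzpatrick function F (y, g), the supremum over (y', g') in gra B of
    <y, g'> + <y', g> - <y', g'>, is convex, bounds the pairing from above and
    coincides with it on gra B. As <y, g> >= - |y|^2 / 2 - |g|^2 / 2, the infimal
    convolution of F with (|.|^2 + |.|^2) / 2 is nonnegative at 0, and the
    Hahn-Banach theorem provides a linear functional l below it. By reflexivity
    l (y, g) = <y, f> + <z, g> for some z and f, and letting the two parts of
    the convolution vary independently gives, for (y, g) in gra B,
      <y - z, g - f> >= |z|^2 / 2 + |f|^2 / 2 + <z, f> >= 0.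
    Maximality puts (z, f) in gra B; taking (y, g) = (z, f) then turns the
    second inequality into an equality, which says that - f is in Delta z.

    The Hahn-Banach theorem is itself obtained by minimality: among the convex
    functions that are nonnegative at 0, a minimal one is linear
    (minimal_convex_linear). *)

Set Implicit Arguments.
Unset Strict Implicit.
Unset Printing Implicit Defensive.

Local Arguments pairing : simpl never.

(** * Hahn-Banach theorem for convex subsets of V * R *)

Section HahnBanach.
Context (R : realType) (V : lmodType R).
Implicit Types (C M N : set (V * R)) (f m k : V -> R).

(** A subset C of V * R is read as a family of constraints: (v, c) in C
    demands l v <= c from the functional l to be found. Working with sets
    rather than with functions defers all infima to a single place, inf_fibre,
    and makes the union of a chain immediate. *)
Definition convex_rel C := forall v w a b t, 0 <= t -> t <= 1 ->
  C (v, a) -> C (w, b) -> C (t *: v + (1 - t) *: w, t * a + (1 - t) * b).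

(** The constraints at 0 are those that every linear functional must be able
    to satisfy. *)
Definition nonneg_at0 C := forall c, C (0, c) -> 0 <= c.

Definition epi f : set (V * R) := [set p | f p.1 <= p.2].

Lemma convex_chord f v w t : convex_rel (epi f) -> 0 <= t -> t <= 1 ->
  f (t *: v + (1 - t) *: w) <= t * f v + (1 - t) * f w.
Proof. by move=> cf t0 t1; apply: (cf v w _ _ t t0 t1); rewrite /epi/=. Qed.

Lemma chord_convex f :
  (forall v w t, 0 <= t -> t <= 1 ->
    f (t *: v + (1 - t) *: w) <= t * f v + (1 - t) * f w) ->
  convex_rel (epi f).
Proof.
move=> cf v w a b t t0 t1; rewrite /epi/= => fa fb.
apply: (le_trans (cf v w t t0 t1)).
by rewrite lerD// ler_wpM2l// subr_ge0.
Qed.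

(** The lower boundary of C. It is finite because the midpoint of a point
    above v and a point above - v is a point above 0, whose height is
    nonnegative. *)
Lemma inf_fibre C : convex_rel C -> nonneg_at0 C ->
    (forall v, exists c, C (v, c)) ->
  exists f, [/\ convex_rel (epi f), 0 <= f 0 & C `<=` epi f].
Proof.
move=> cC C0 CV; pose F v := [set c | C (v, c)].
have F_neq0 v : F v !=set0 by have [c] := CV v; exists c.
have F_lb v : has_lbound (F v).
  have [b Cb] := CV (- v); exists (- b) => a Ca.
  have h0 : 0 <= 2^-1 :> R by [].
  have h1 : 2^-1 <= 1 :> R by rewrite invf_le1// ler1n.
  have := cC _ _ _ _ _ h0 h1 Ca Cb.
  have -> : 1 - 2^-1 = 2^-1 :> R by lra.
  rewrite scalerN subrr => /C0; lra.
exists (fun v => inf (F v)); split.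
- apply: chord_convex => v w t t0 t1.
  apply/ler_addgt0Pr => e e0.
  have [a Fa /ltW ae] := inf_adherent e0 (conj (F_neq0 v) (F_lb v)).
  have [b Fb /ltW be] := inf_adherent e0 (conj (F_neq0 w) (F_lb w)).
  apply: (@le_trans _ _ (t * a + (1 - t) * b)).
    by apply: ge_inf => //; exact: cC.
  have t1' : 0 <= 1 - t by rewrite subr_ge0.
  have := lerD (ler_wpM2l t0 ae) (ler_wpM2l t1' be); lra.
- by apply: lb_le_inf => // c; exact: C0.
- by move=> [v c] Cc; exact: ge_inf.
Qed.

(** Zorn's lemma is applied to the sets M for which C `|` M, rather than M,
    has the two properties, so that the empty chain is no exception. *)
Lemma ex_maximal_convex_rel C : convex_rel C -> nonneg_at0 C ->
  exists M, [/\ C `<=` M, convex_rel M, nonneg_at0 M &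
    forall N, M `<=` N -> convex_rel N -> nonneg_at0 N -> N `<=` M].
Proof.
move=> cC C0.
pose P M := convex_rel (C `|` M) /\ nonneg_at0 (C `|` M).
have P0 : P set0 by rewrite /P setU0.
have [F FP Ftot|M [[cM M0] Mmax]] := @Zorn_bigcup _ P.
- have common p q : (C `|` \bigcup_(X in F) X) p ->
      (C `|` \bigcup_(X in F) X) q ->
      exists X, [/\ P X, X `<=` \bigcup_(X in F) X, (C `|` X) p & (C `|` X) q].
    move=> [Cp|[X FX Xp]] [Cq|[Y FY Yq]].
    + by exists set0; split=> //; left.
    + by exists Y; split; [exact: FP|exact: bigcup_sup|left|right].
    + by exists X; split; [exact: FP|exact: bigcup_sup|right|left].
    + have [XY|YX] := Ftot _ _ FX FY.
        by exists Y; split; [exact: FP|exact: bigcup_sup|right; exact: XY|right].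
      by exists X; split; [exact: FP|exact: bigcup_sup|right|right; exact: YX].
  split.
    move=> v w a b t t0 t1 Ca Cb.
    have [X [[cX _] XF Xa Xb]] := common _ _ Ca Cb.
    exact: (setUS XF (cX _ _ _ _ _ t0 t1 Xa Xb)).
  move=> c Cc; have [X [[_ X0] _ Xc _]] := common _ _ Cc Cc.
  exact: X0.
- exists (C `|` M); split=> // N MN cN N0.
  have CN : C `|` N = N by apply/setUidPr => p Cp; apply: MN; left.
  have PN : P N by rewrite /P CN.
  apply: contrapT => NM; apply: (Mmax N) => //; split.
    by move=> p Mp; apply: MN; right.
  by move=> NM'; apply: NM; apply: (subset_trans NM'); exact: subsetUr.
Qed.

(** A maximal set of constraints is the epigraph of a minimal function. *)
Lemma ex_minimal_convex C : convex_rel C -> nonneg_at0 C ->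
    (forall v, exists c, C (v, c)) ->
  exists m, [/\ convex_rel (epi m), 0 <= m 0, C `<=` epi m &
    forall k, convex_rel (epi k) -> 0 <= k 0 -> (forall v, k v <= m v) ->
      k =1 m].
Proof.
move=> cC C0 CV; have [M [CM cM M0 Mmax]] := ex_maximal_convex_rel cC C0.
have MV v : exists c, M (v, c) by have [c /CM] := CV v; exists c.
have [m [cm m0 Mm]] := inf_fibre cM M0 MV.
exists m; split=> //; first exact: subset_trans Mm.
move=> k ck k0 km v; apply/eqP; rewrite eq_le km/=.
apply: (Mm (v, k v)); apply: (Mmax (epi k)); rewrite ?/epi//=.
- by move=> p /Mm; rewrite /epi/=; exact: le_trans.
- by move=> c; rewrite /=; exact: le_trans.
Qed.

(** Minimality applied to three convex functions below m gives linearity: v |-> m v - m 0 shows that m 0 = 0;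
    v |-> t^-1 * m (t *: v), for t in ]0, 1], shows positive homogeneity, hence
    sublinearity; and v |-> m (v + w) - m w, below m by sublinearity, shows
    additivity. *)
Lemma minimal_convex_linear m : convex_rel (epi m) -> 0 <= m 0 ->
    (forall k, convex_rel (epi k) -> 0 <= k 0 -> (forall v, k v <= m v) ->
      k =1 m) ->
  linear (m : V -> R^o).
Proof.
move=> cm m_ge0 mmin.
have m0 : m 0 = 0.
  have /(_ 0) : (fun v => m v - m 0) =1 m; last by rewrite subrr.
  apply: mmin => [|/=|v]; last 2 first.
  - by rewrite subrr.
  - by rewrite gerBl.
  apply: chord_convex => v w t t0 t1.
  have := convex_chord v w cm t0 t1; lra.
have homog1 t v : 0 < t -> t <= 1 -> m (t *: v) = t * m v.
  move=> t0 t1.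
  have /(_ v) <- : (fun v => t^-1 * m (t *: v)) =1 m; last first.
    by rewrite mulrA mulfV ?mul1r// gt_eqF.
  apply: mmin => [|/=|w]; last 2 first.
  - by rewrite scaler0 m0 mulr0.
  - rewrite ler_pdivrMl//.
    have := convex_chord w 0 cm (ltW t0) t1.
    by rewrite scaler0 addr0 m0 mulr0 addr0.
  apply: chord_convex => w z s s0 s1.
  have -> : t *: (s *: w + (1 - s) *: z) =
      s *: (t *: w) + (1 - s) *: (t *: z).
    by rewrite scalerDr !scalerA mulrC (mulrC t).
  have -> : s * (t^-1 * m (t *: w)) + (1 - s) * (t^-1 * m (t *: z)) =
      t^-1 * (s * m (t *: w) + (1 - s) * m (t *: z)) by ring.
  by rewrite ler_pM2l ?invr_gt0//; exact: convex_chord.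
have homog t v : 0 < t -> m (t *: v) = t * m v.
  move=> t0; have [t1|/ltW t1] := leP t 1; first exact: homog1.
  have /homog1 : 0 < t^-1 by rewrite invr_gt0.
  move=> /(_ (t *: v)); rewrite invf_le1// => /(_ t1).
  rewrite scalerA mulVf ?gt_eqF// scale1r => ->.
  by rewrite mulrA mulfV ?mul1r// gt_eqF.
have subadd v w : m (v + w) <= m v + m w.
  have h0 : 0 <= 2^-1 :> R by [].
  have h1 : 2^-1 <= 1 :> R by rewrite invf_le1// ler1n.
  have := convex_chord v w cm h0 h1.
  have -> : 1 - 2^-1 = 2^-1 :> R by lra.
  by rewrite -scalerDr homog ?invr_gt0// -mulrDr ler_pM2l ?invr_gt0.
have add v w : m (v + w) = m v + m w.
  have /(_ v) <- : (fun v => m (v + w) - m w) =1 m; last by rewrite subrK.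
  apply: mmin => [|/=|z]; last 2 first.
  - by rewrite add0r subrr.
  - by rewrite lerBlDr.
  apply: chord_convex => z z' t t0 t1.
  have := convex_chord (z + w) (z' + w) cm t0 t1.
  rewrite !scalerDr addrACA -scalerDl subrKC scale1r; lra.
have opp v : m (- v) = - m v.
  by apply/eqP; rewrite -addr_eq0 -add addNr m0.
move=> a v w; rewrite add; congr (_ + _).
have [a0|a0|->] := ltgtP a 0; last by rewrite !scale0r m0.
  by rewrite -[a]opprK scaleNr opp homog ?oppr_gt0// scaleNr.
exact: homog.
Qed.

Theorem hahn_banach_rel C : convex_rel C -> nonneg_at0 C ->
    (forall v, exists c, C (v, c)) ->
  exists2 l : V -> R^o, linear l & forall v c, C (v, c) -> l v <= c.
Proof.
move=> cC C0 CV; have [m [cm m0 Cm mmin]] := ex_minimal_convex cC C0 CV.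
exists m; first exact: minimal_convex_linear.
by move=> v c /Cm.
Qed.

End HahnBanach.

(** * Functionals on a normed space *)

Section Dual.
Context (R : realType) (X : normedModType R).

Lemma pairing0l (f : dual X) : pairing 0 f = 0.
Proof. by rewrite -(scale0r (0 : X)) pairingZl mul0r. Qed.

Lemma pairingNl x (f : dual X) : pairing (- x) f = - pairing x f.
Proof. by rewrite -scaleN1r pairingZl mulN1r. Qed.

Lemma pairingNr x (f : dual X) : pairing x (- f) = - pairing x f.
Proof. by []. Qed.

Lemma pairingBB (x y : X) (f g : dual X) :
  pairing (x - y) (f - g) =
  pairing x f - pairing x g - pairing y f + pairing y g.
Proof. by rewrite pairingDl !pairingDr pairingNl !pairingNr pairingNl; ring. Qed.

Lemma bounded_above_dual (l : X -> R^o) M : linear l ->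
    (forall x, `|x| <= 1 -> l x <= M) ->
  exists f : dual X, forall x, pairing x f = l x.
Proof.
move=> ll lM.
pose g : {linear X -> R^o} := HB.pack l (GRing.isLinear.Build _ _ _ _ _ ll).
have lN x : l (- x) = - l x by exact: (linearN g).
have lZ a x : l (a *: x) = a * l x by exact: (linearZ_LR g).
have lb x : `|x| <= 1 -> `|l x| <= M.
  by move=> x1; rewrite ler_norml lM// andbT lerNl -lN lM// normrN.
have cl : continuous l.
  apply: (@bounded_linear_continuous _ _ _ g); apply/bounded_funP => r.
  exists ((`|r| + 1) * M) => x xr; rewrite -[g x]/(l x).
  have r0 : 0 < `|r| + 1 by rewrite ltr_wpDl.
  have := lb ((`|r| + 1)^-1 *: x).
  rewrite normrZ lZ normrM gtr0_norm ?invr_gt0//.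
  rewrite !ler_pdivrMl// mulr1; apply.
  by rewrite (le_trans xr)// (le_trans (ler_norm r))// lerDl.
have lP : l \in @dual_pred R X by rewrite inE; split.
by exists (Dual lP).
Qed.

(** The functional is dominated by v |-> |v + t x| - t |x| for every t: t = 0
    bounds it by the norm, and t = 1 at v = - x forces its value at x. *)
Lemma norming_functional (x : X) :
  exists2 f : dual X, `|f| <= 1 & `|x| <= pairing x f.
Proof.
pose C := [set p : X * R | exists t, `|p.1 + t *: x| - t * `|x| <= p.2].
have [||v|l ll lC] := @hahn_banach_rel R X C.
- move=> v w a b t t0 t1 [s /= sa] [s' /= sb].
  exists (t * s + (1 - t) * s') => /=.
  have t1' : 0 <= 1 - t by rewrite subr_ge0.
  have -> : t *: v + (1 - t) *: w + (t * s + (1 - t) * s') *: x =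
      t *: (v + s *: x) + (1 - t) *: (w + s' *: x).
    by rewrite !scalerDr !scalerA (scalerDl x) addrACA.
  have := ler_normD (t *: (v + s *: x)) ((1 - t) *: (w + s' *: x)).
  rewrite !normrZ (ger0_norm t0) (ger0_norm t1').
  have := lerD (ler_wpM2l t0 sa) (ler_wpM2l t1' sb); lra.
- move=> c [t /=]; rewrite add0r normrZ; apply: le_trans.
  by rewrite subr_ge0 ler_wpM2r// ler_norm.
- by exists `|v|, 0; rewrite /= scale0r addr0 mul0r subr0.
- have l_le v : l v <= `|v|.
    by apply: lC; exists 0; rewrite /= scale0r addr0 mul0r subr0.
  have [f fE] := bounded_above_dual ll (fun v => le_trans (l_le v)).
  exists f.
    rewrite dual_normE; apply: dual_norm_le => v; apply: le_trans.
    by rewrite ler_norml fE l_le andbT lerNl -fE -pairingNl fE -normrN.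
  rewrite -lerN2 -pairingNl fE; apply: lC; exists 1.
  by rewrite /= scale1r addNr normr0 mul1r sub0r.
Qed.

Lemma bidual_embed_norm_ge (x : X) : `|x| <= `|bidual_embed x|.
Proof.
have [f f1 xf] := norming_functional x.
apply: (le_trans xf); apply: (le_trans (ler_norm _)).
by rewrite dual_normE; apply: (le_dual_norm1 (bidual_embed x)).
Qed.

(** This computes half of the conjugate of |.|^2 / 2. On the line
    spanned by a unit vector x the infimum is - <x, f>^2 / 2, attained at
    - <x, f> x. *)
Lemma dual_norm_sqr_le (f : dual X) K :
  (forall x, 0 <= 2^-1 * `|x| ^+ 2 + pairing x f + K) ->
  2^-1 * `|f| ^+ 2 <= K.
Proof.
move=> fK.
have K0 : 0 <= K by have := fK 0; rewrite pairing0l normr0 expr0n mulr0 !add0r.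
have : `|f| <= Num.sqrt (2 * K).
  rewrite dual_normE; apply: dual_norm_le => x x1.
  rewrite -sqrtr_sqr ler_wsqrtr//.
  have := fK (- pairing x f *: x).
  rewrite pairingZl normrZ normrN exprMn real_normK ?num_real//.
  have : `|x| ^+ 2 <= 1 by rewrite expr_le1.
  have := sqr_ge0 (pairing x f); nra.
rewrite -(ler_pXn2r (n := 2)) ?nnegrE ?sqrtr_ge0// sqr_sqrtr; lra.
Qed.

Lemma pairing_young x (f : dual X) :
  - pairing x f <= 2^-1 * `|x| ^+ 2 + 2^-1 * `|f| ^+ 2.
Proof.
have := le_dual_norm x f; rewrite -dual_normE ler_norml => /andP[h _].
have := sqr_ge0 (`|x| - `|f|); nra.
Qed.

(** Equality in pairing_young forces |x| = |f|, because
    - <x, f> <= |x| |f|. *)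
Lemma duality_map_young x (f : dual X) :
  2^-1 * `|x| ^+ 2 + 2^-1 * `|f| ^+ 2 <= - pairing x f -> duality_map x (- f).
Proof.
move=> xf; have := le_dual_norm x f; rewrite -dual_normE ler_norml => /andP[h _].
have e : `|x| - `|f| = 0.
  by apply/eqP; rewrite -sqrf_eq0 eq_le sqr_ge0 andbT; nra.
have e' : `|x| = `|f| by lra.
have fx : pairing x f = - (`|x| * `|x|) by rewrite -e' in xf h; nra.
rewrite /duality_map /mkset pairingNr normrN -e' fx opprK; split=> //; ring.
Qed.

End Dual.

(** The gap is at least t (1 - t) (|v| - |w|)^2. *)
Lemma sqr_norm_convex (R : realType) (V : normedModType R) (v w : V) (t : R) :
  0 <= t -> t <= 1 ->
  `|t *: v + (1 - t) *: w| ^+ 2 <= t * `|v| ^+ 2 + (1 - t) * `|w| ^+ 2.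
Proof.
move=> t0 t1; have t1' : 0 <= 1 - t by rewrite subr_ge0.
apply: (@le_trans _ _ ((t * `|v| + (1 - t) * `|w|) ^+ 2)).
  rewrite ler_pXn2r ?nnegrE ?addr_ge0 ?mulr_ge0//.
  by rewrite (le_trans (ler_normD _ _))// !normrZ !ger0_norm.
have := mulr_ge0 (mulr_ge0 t0 t1') (sqr_ge0 (`|v| - `|w|)); nra.
Qed.

(** * Maximally monotone operators and the duality mapping *)

Section Monotone.
Context (R : realType) (X : normedModType R).
Implicit Types (A B : X -> set (dual X)).

Lemma maximally_monotoneP A q q' : maximally_monotone A -> gra A q ->
  gra A q' -> 0 <= pairing (q.1 - q'.1) (q.2 - q'.2).
Proof. by move=> Amax /Amax; exact. Qed.

(** The epigraph of the Fitzpatrick function, used in place of the function to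
    avoid infinite values. *)
Definition fitzpatrick_epi B : set (X * dual X * R) :=
  [set p | forall q, gra B q ->
    pairing p.1.1 q.2 + pairing q.1 p.1.2 - pairing q.1 q.2 <= p.2].

Lemma fitzpatrick_gra B q : maximally_monotone B -> gra B q ->
  fitzpatrick_epi B (q, pairing q.1 q.2).
Proof.
move=> Bmax Bq q' Bq' /=.
have := maximally_monotoneP Bmax Bq Bq'; rewrite pairingBB; lra.
Qed.

(** If w were a point where the Fitzpatrick function lies below the pairing,
    w would be monotonically related to gra B, hence in gra B, where the two
    coincide. *)
Lemma fitzpatrick_ge_pairing B w r : maximally_monotone B ->
  fitzpatrick_epi B (w, r) -> pairing w.1 w.2 <= r.
Proof.
move=> Bmax wr; rewrite leNgt; apply/negP => rw.
have Bw : gra B w.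
  by apply/Bmax => q /wr /=; rewrite pairingBB; lra.
have := wr w Bw; rewrite /=; lra.
Qed.

Lemma maximally_monotone_neq0 B : maximally_monotone B -> gra B !=set0.
Proof.
move=> Bmax; apply/set0P/eqP => B0.
have : gra B (0, 0) by apply/Bmax => q; rewrite B0.
by rewrite B0.
Qed.

(** Rockafellar's theorem that B + Delta has 0 in its range. The set C is the
    epigraph of the infimal convolution of the Fitzpatrick function with
    (|.|^2 + |.|^2) / 2, and Young's inequality makes it nonnegative at 0. *)
Theorem maximally_monotone_duality_map B : reflexive_space X ->
  maximally_monotone B -> exists z f, B z f /\ duality_map z (- f).
Proof.
move=> Xrefl Bmax.
pose C := [set p : (X * dual X) * R | exists w r, fitzpatrick_epi B (w, r) /\
  r + 2^-1 * `|w.1 - p.1.1| ^+ 2 + 2^-1 * `|w.2 - p.1.2| ^+ 2 <= p.2].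
have [||v|l ll lC] := @hahn_banach_rel R (X * dual X)%type C.
- move=> v v' a a' t t0 t1 [w [r [wr wa]]] [w' [r' [wr' wa']]].
  have t1' : 0 <= 1 - t by rewrite subr_ge0.
  exists (t *: w + (1 - t) *: w'), (t * r + (1 - t) * r'); split.
    move=> q Bq /=.
    have := ler_wpM2l t0 (wr q Bq); have := ler_wpM2l t1' (wr' q Bq).
    rewrite /= pairingDl !pairingDr !pairingZl !pairingZr; lra.
  have comb (V : lmodType R) (x x' y y' : V) :
      t *: x + (1 - t) *: x' - (t *: y + (1 - t) *: y') =
      t *: (x - y) + (1 - t) *: (x' - y').
    by rewrite opprD addrACA !scalerBr.
  rewrite /= !comb.
  have := sqr_norm_convex (w.1 - v.1) (w'.1 - v'.1) t0 t1.
  have := sqr_norm_convex (w.2 - v.2) (w'.2 - v'.2) t0 t1.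
  have := ler_wpM2l t0 wa; have := ler_wpM2l t1' wa'.
  rewrite /=; lra.
- move=> c [w [r [/(fitzpatrick_ge_pairing Bmax) wr]]] /=.
  have := pairing_young w.1 w.2; rewrite !subr0; lra.
- have [q Bq] := maximally_monotone_neq0 Bmax.
  exists (pairing q.1 q.2 + 2^-1 * `|q.1 - v.1| ^+ 2
    + 2^-1 * `|q.2 - v.2| ^+ 2), q, (pairing q.1 q.2).
  by split; first exact: fitzpatrick_gra.
- have lD v w : l (v + w) = l v + l w.
    by have := ll 1 v w; rewrite !scale1r.
  have l0 : l 0 = 0 by have := lD 0 0; rewrite addr0; lra.
  have lN v : l (- v) = - l v by have := lD v (- v); rewrite subrr l0; lra.
  (* Evaluating l at q - (x, f) turns the bound on l into a sum of a part that
     depends on q only and a part that depends on (x, f) only. *)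
  have key q x f : gra B q -> 0 <= pairing q.1 q.2 - l q
      + 2^-1 * `|x| ^+ 2 + 2^-1 * `|f| ^+ 2 + l (x, f).
    move=> Bq; have : l (q - (x, f)) <= pairing q.1 q.2
        + 2^-1 * `|x| ^+ 2 + 2^-1 * `|f| ^+ 2.
      apply: lC; exists q, (pairing q.1 q.2); split.
        exact: fitzpatrick_gra.
      by rewrite /= !subKr.
    rewrite lD lN; lra.
  have [q0 Bq0] := maximally_monotone_neq0 Bmax.
  have lin1 : linear (fun x : X => l (x, 0)).
    move=> a x y; rewrite -(ll a (x, 0) (y, 0)); congr l.
    by congr (_, _); rewrite /= scaler0 addr0.
  have lin2 : linear (fun f : dual X => l (0, f)).
    move=> a x y; rewrite -(ll a (0, x) (0, y)); congr l.
    by congr (_, _); rewrite /= scaler0 addr0.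
  have sqr1 (V : normedModType R) (v : V) : `|v| <= 1 -> `|v| ^+ 2 <= 1.
    by move=> v1; rewrite expr_le1.
  have [f fE] : exists f : dual X, forall x, pairing x f = l (x, 0).
    apply: (@bounded_above_dual _ _ _ (pairing q0.1 q0.2 - l q0 + 2^-1)) => //.
    move=> x x1; rewrite -[x]opprK -[0]opprK -[(_, _)]/(- (- x, - 0)) lN.
    have := key q0 (- x) (- 0) Bq0.
    rewrite oppr0 normr0 normrN; have := sqr1 _ _ x1; lra.
  have [phi phiE] : exists phi : dual (dual X),
      forall g, pairing g phi = l (0, g).
    apply: (@bounded_above_dual _ _ _ (pairing q0.1 q0.2 - l q0 + 2^-1)) => //.
    move=> x x1; rewrite -[x]opprK -[0]opprK -[(_, _)]/(- (- 0, - x)) lN.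
    have := key q0 (- 0) (- x) Bq0.
    rewrite oppr0 normr0 normrN; have := sqr1 _ _ x1; lra.
  have [z _ zE] : range (@bidual_embed R X) phi by rewrite Xrefl.
  have {}phiE g : l (0, g) = pairing z g by rewrite -phiE -zE.
  have lE x g : l (x, g) = pairing x f + pairing z g.
    by rewrite fE -phiE -lD; congr l; congr (_, _); rewrite ?addr0 ?add0r.
  (* Minimize the part in (x, g): over x it contributes - |f|^2 / 2, and over g
     it contributes - |z|^2 / 2, the bidual norm of z being that of z. *)
  have conj q : gra B q ->
      2^-1 * `|z| ^+ 2 + 2^-1 * `|f| ^+ 2 <= pairing q.1 q.2 - l q.
    move=> Bq; rewrite -lerBrDr.
    apply: (@le_trans _ _ (2^-1 * `|bidual_embed z| ^+ 2)).
      rewrite ler_pM2l ?invr_gt0// ler_pXn2r ?nnegrE//.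
      exact: bidual_embed_norm_ge.
    apply: dual_norm_sqr_le => g.
    rewrite -[pairing g _]/(pairing z g).
    suff: 2^-1 * `|f| ^+ 2 <=
        2^-1 * `|g| ^+ 2 + pairing z g + pairing q.1 q.2 - l q by lra.
    apply: dual_norm_sqr_le => x.
    by have := key q x g Bq; rewrite lE; lra.
  have zf : gra B (z, f).
    apply/Bmax => q Bq; have := conj q Bq; case: q Bq => y g Bq /=.
    rewrite lE pairingBB; have := pairing_young z f; lra.
  exists z, f; split=> //; apply: duality_map_young.
  have := conj _ zf; rewrite /= lE; lra.
Qed.

(** * The metric resolvent *)

Lemma subrDD (V : zmodType) (a b c : V) : a + c - (b + c) = a - b.
Proof. by rewrite opprD addrACA subrr addr0. Qed.

Lemma gra_scale_shift gamma A u (x : X) y f : 0 < gamma ->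
  scale_shift gamma A u (y + x) f <-> A (y + x) (gamma^-1 *: f + u).
Proof.
move=> gamma0; have g0 : gamma != 0 by rewrite gt_eqF.
split=> [[g Ag <-]|Af].
  by rewrite scalerA mulVf// scale1r subrK.
by exists (gamma^-1 *: f + u) => //; rewrite addrK scalerA mulfV// scale1r.
Qed.

Lemma maximally_monotone_affine gamma A u (x : X) : 0 < gamma ->
  maximally_monotone A ->
  maximally_monotone (fun y => scale_shift gamma A u (y + x)).
Proof.
move=> gamma0 Amax [y f]; have g0 : gamma != 0 by rewrite gt_eqF.
have pairE z g :
    pairing (y + x - (z + x)) (gamma^-1 *: f + u - (gamma^-1 *: g + u)) =
      gamma^-1 * pairing (y - z) (f - g).
  by rewrite !subrDD -scalerBr pairingZr.
split=> [/(gra_scale_shift _ _ _ _ _ gamma0) yf [z g]|yf].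
  move=> /(gra_scale_shift _ _ _ _ _ gamma0) zg.
  have := @maximally_monotoneP A (y + x, gamma^-1 *: f + u)
    (z + x, gamma^-1 *: g + u) Amax yf zg.
  by rewrite /= pairE pmulr_rge0 ?invr_gt0.
apply/(gra_scale_shift _ _ _ _ _ gamma0).
rewrite -[A _ _]/(gra A (y + x, gamma^-1 *: f + u)).
apply/Amax => -[z g] zg /=.
have gE : gamma^-1 *: (gamma *: (g - u)) + u = g.
  by rewrite scalerA mulVf// scale1r subrK.
have := pairE (z - x) (gamma *: (g - u)).
rewrite gE subrK => ->; rewrite pmulr_rge0 ?invr_gt0//.
by apply: (yf (z - x, _)); exists g; rewrite //= subrK.
Qed.

Lemma metric_resolvent_scale_shiftP gamma A u (x z : X) :
  metric_resolvent (scale_shift gamma A u) x z <->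
  exists2 f, A z f & duality_map (z - x) (gamma *: (u - f)).
Proof.
split=> [[_ [f Azf <-] [g zg e]]|[f Azf zf]].
  exists f => //; suff -> : gamma *: (u - f) = g by [].
  by rewrite -opprB scalerN; apply/eqP; rewrite eq_sym -addr_eq0 addrC e.
exists (gamma *: (f - u)); first by exists f.
by exists (gamma *: (u - f)) => //; rewrite -(opprB f u) scalerN subrr.
Qed.

Lemma metric_resolvent_neq0 gamma A u (x : X) : reflexive_space X -> 0 < gamma ->
  maximally_monotone A -> metric_resolvent (scale_shift gamma A u) x !=set0.
Proof.
move=> Xrefl gamma0 Amax.
have [z [f [zf fz]]] := maximally_monotone_duality_map Xrefl
  (maximally_monotone_affine u x gamma0 Amax).
exists (z + x); exists f => //; exists (- f); rewrite ?addrK ?subrr//.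
Qed.

Lemma metric_resolvent_Haraux gamma A u (x z : X) : 0 < gamma ->
  metric_resolvent (scale_shift gamma A u) x z ->
  ((`|x - z| ^+ 2 / gamma)%:E <= Haraux A x u)%E.
Proof.
move=> gamma0 /metric_resolvent_scale_shiftP[f Azf [zf _]].
have -> : `|x - z| ^+ 2 / gamma = pairing (x - z) (f - u).
  rewrite distrC zf pairingZr mulrAC mulfV ?gt_eqF// mul1r.
  by rewrite -(opprB x z) -(opprB f u) pairingNl pairingNr opprK.
by apply: ereal_sup_ubound; exists (z, f).
Qed.

Lemma metric_resolvent_dist gamma A u (x z : X) : 0 < gamma ->
  metric_resolvent (scale_shift gamma A u) x z ->
  ((2^-1)%:E * dist_gamma gamma (gra A) (x, u) ^+ 2 <=
    (`|x - z| ^+ 2 / gamma)%:E)%E.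
Proof.
move=> gamma0 /metric_resolvent_scale_shiftP[f Azf [zf]].
rewrite -zf normrZ gtr0_norm// distrC => e.
have dist0 : (0 <= dist_gamma gamma (gra A) (x, u))%E.
  by apply: le_ereal_inf_tmp => _ [q _ <-]; rewrite lee_fin sqrtr_ge0.
have dist_le : (dist_gamma gamma (gra A) (x, u) <=
    (norm_gamma gamma ((x, u) - (z, f)))%:E)%E.
  by apply: ereal_inf_lbound; exists (z, f).
have normE : norm_gamma gamma ((x, u) - (z, f)) ^+ 2 =
    2 * (`|x - z| ^+ 2 / gamma).
  have g0 : gamma != 0 by rewrite gt_eqF.
  rewrite /norm_gamma sqr_sqrtr /=; last first.
    by rewrite addr_ge0// ?divr_ge0 ?mulr_ge0// ltW.
  have -> : gamma * `|u - f| ^+ 2 = `|x - z| ^+ 2 / gamma.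
    by rewrite e; field.
  by rewrite mulr_natl mulr2n.
have -> : `|x - z| ^+ 2 / gamma =
    2^-1 * norm_gamma gamma ((x, u) - (z, f)) ^+ 2.
  by rewrite normE mulKf.
rewrite EFinM EFin_expe; apply: lee_wpmul2l; first by rewrite lee_fin.
by rewrite lee_sqr// lee_fin sqrtr_ge0.
Qed.

(** With a = z - x, b = z' - x and duality images j of a and j' of b,
    monotonicity reads |a|^2 + |b|^2 <= <a, j'> + <b, j> <= 2 |a| |b|. Hence
    |a| = |b| and <b, j> = |a|^2, so <a + b, j> = 2 |a|^2 and the midpoint of
    a / |a| and b / |a| has norm 1. *)
Lemma metric_resolvent_unique gamma A u (x z z' : X) : strictly_convex X ->
  0 < gamma -> maximally_monotone A ->
  metric_resolvent (scale_shift gamma A u) x z ->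
  metric_resolvent (scale_shift gamma A u) x z' -> z = z'.
Proof.
move=> Xsc gamma0 Amax /metric_resolvent_scale_shiftP[f Azf].
move=> + /metric_resolvent_scale_shiftP[f' Azf'].
set a := z - x; set b := z' - x; set j := gamma *: _; set j' := gamma *: _.
move=> [aj jn] [bj' j'n].
have mono : pairing (a - b) (j - j') <= 0.
  have := @maximally_monotoneP _ (z, f) (z', f') Amax Azf Azf'.
  rewrite /a /b /j /j' subrDD -scalerBr pairingZr pmulr_rle0//.
  by rewrite ![u + _]addrC subrDD -opprD pairingNr oppr_le0.
have jN : `|j| = `|a|.
  by apply/eqP; rewrite -(eqrXn2 (n := 2))// aj jn.
have j'N : `|j'| = `|b|.
  by apply/eqP; rewrite -(eqrXn2 (n := 2))// bj' j'n.
have aj' := le_trans (ler_norm _) (le_dual_norm a j').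
have bj := le_trans (ler_norm _) (le_dual_norm b j).
rewrite -dual_normE jN in bj; rewrite -dual_normE j'N in aj'.
move: mono; rewrite pairingBB -aj -bj' => mono.
have ab : `|a| - `|b| = 0.
  by apply/eqP; rewrite -sqrf_eq0 eq_le sqr_ge0 andbT; nra.
have {ab}ab : `|b| = `|a| by lra.
rewrite ab in mono bj aj'.
have {}bj : pairing b j = `|a| ^+ 2 by lra.
suff : a = b by move=> /(congr1 (+%R^~ x)); rewrite !subrK.
apply/eqP; apply: contrapT => /negP anb.
have a0 : 0 < `|a|.
  rewrite normr_gt0; apply: contra_neq anb => a0.
  by apply/esym/eqP; rewrite a0 -normr_eq0 ab a0 normr0.
have unit (c : X) : `|c| = `|a| -> `|(`|a|^-1 *: c)| = 1.
  by move=> ca; rewrite normrZ ca ger0_norm ?invr_ge0// mulVf// gt_eqF.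
have ne : `|a|^-1 *: a != `|a|^-1 *: b.
  apply: contra_neq anb => /(congr1 ( *:%R `|a|)).
  by rewrite !scalerA mulfV ?gt_eqF// !scale1r.
have ab2 : 2 * `|a| <= `|a + b|.
  have := le_trans (ler_norm _) (le_dual_norm (a + b) j).
  rewrite pairingDl -aj bj -dual_normE jN => h.
  by rewrite -(ler_pM2l a0); lra.
have := Xsc _ _ (unit a erefl) (unit b ab) ne.
rewrite -scalerDr scalerA normrZ ger0_norm ?mulr_ge0 ?invr_ge0//.
by rewrite -invfM ltr_pdivrMl ?mulr_gt0// mulr1 ltNge ab2.
Qed.

End Monotone.
Unset Implicit Arguments.
Set Strict Implicit.
Set Printing Implicit Defensive.

Theorem theorem3p6 (R : realType) (X : completeNormedModType R)
    (X_neq0 : exists x0 : X, x0 != 0) (X_reflexive : reflexive_space X)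
    (A : X -> set (dual X)) (A_maxmon : maximally_monotone A)
    (x : X) (u : dual X) (gamma : R) (gamma_gt0 : 0 < gamma) :
  let Res := metric_resolvent (scale_shift gamma A u) in
  [/\ Res x !=set0,
      (forall z : X, Res x z ->
        ((`|x - z| ^+ 2 / gamma)%:E <= Haraux A x u)%E /\
        ((2^-1)%:E * dist_gamma gamma (gra A) (x, u) ^+ 2
           <= (`|x - z| ^+ 2 / gamma)%:E)%E)
    & (strictly_convex X ->
        [/\ single_valued Res,
            ((`|x - value_at Res x| ^+ 2 / gamma)%:E <= Haraux A x u)%E
          & ((2^-1)%:E * dist_gamma gamma (gra A) (x, u) ^+ 2
               <= (`|x - value_at Res x| ^+ 2 / gamma)%:E)%E])].
Proof.
have Haraux_ge z := @metric_resolvent_Haraux R X gamma A u x z gamma_gt0.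
have dist_le z := @metric_resolvent_dist R X gamma A u x z gamma_gt0.
have neq0 y := @metric_resolvent_neq0 R X gamma A u y X_reflexive gamma_gt0
  A_maxmon.
split=> [|z xz|X_sc]; [exact: neq0|by split; auto|].
have xval : metric_resolvent (scale_shift gamma A u) x
    (value_at (metric_resolvent (scale_shift gamma A u)) x).
  have [z xz] := neq0 x; exact: (xgetI 0 xz).
split; [|by auto|by auto] => y.
have [z yz] := neq0 y; exists z; apply/seteqP; split=> [z' yz'|_ ->//].
exact: (metric_resolvent_unique X_sc gamma_gt0 A_maxmon yz' yz).
Qed.
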